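(* There exist an absolute constant $c>0$, an absolute constant $C>0$ and an integer $n_0$ such that for every $n \ge n_0$ and every set $S \subseteq \mathbb{C}[x]$ consisting of $n$ monic polynomials, $$|S.S| < n^{1+c} \quad\Longrightarrow\quad |S+S| \ge C n^2 .$$
   Context: For a finite subset $S$ of a ring, $S.S := \{st : s,t\in S\}$ and $S+S := \{s+t : s,t\in S\}$. *)

(* Defs.v *)
From mathcomp Require Import all_boot all_order all_algebra.
From mathcomp Require Import finmap complex.
From mathcomp Require Import reals exp.

Set Implicit Arguments.
Unset Strict Implicit.
Unset Printing Implicit Defensive.

Import GRing.Theory Num.Theory.

Local Open Scope fset_scope.
Local Open Scope ring_scope.

Definition sumset (A : pzRingType) (S : {fset A}) : {fset A} :=
  [fset s + t | s in S, t in S].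

Definition prodset (A : pzRingType) (S : {fset A}) : {fset A} :=
  [fset s * t | s in S, t in S].

(* Main.v *)
Require Import Defs.
From mathcomp Require Import all_boot all_order all_fingroup all_algebra.
From mathcomp Require Import finmap complex.
From mathcomp Require Import reals exp.
From mathcomp Require Import boolp zify ring.

(* Fix a large [k]. Wronskians show that k-th powers of few distinct monic
   polynomials are linearly independent over C; hence a short signed sum of k-th
   powers of monic fractions vanishes only by cancelling in pairs.
   If [S.S] is small then, by Pluennecke's inequality, [S S^k] is small, and since
   [r t^k] determines the class of [r] modulo k-th powers, [S] meets only few such
   classes. In an equation [s1 + s2 = s3 + s4] with the four classes prescribed,
   [s_i = r_i x_i] with [x_i] a k-th power, so the [x] are solutions in k-th
   powers of a fixed linear equation. The minors of a matrix whose rows are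
   solutions are signed sums of k-th powers; the resulting formal cancellations
   force the nondegenerate solutions into boundedly many directions. So few pairs
   [(s1, s2)] have a sum with another representation, and the remaining pairs
   already give about [n^2 / 2] distinct sums. *)

Set Implicit Arguments.
Unset Strict Implicit.
Unset Printing Implicit Defensive.

Import Order.TTheory GRing.Theory Num.Theory.

Local Open Scope fset_scope.
Local Open Scope ring_scope.

(** * Linear independence of powers of monic polynomials *)

Section Wronskian.
Variable F : numClosedFieldType.
Implicit Types p q : {poly F}.

Definition wronskian_mx d (p : 'I_d -> {poly F}) : 'M[{poly F}]_d :=
  \matrix_(i, j) (p j)^`(i).

Definition lin_indep d (p : 'I_d -> {poly F}) : Prop :=
  forall c : 'I_d -> F, \sum_j c j *: p j = 0 -> forall j, c j = 0.

Lemma derivn_comp_XaddC p a n : (p \Po ('X + a%:P))^`(n) = p^`(n) \Po ('X + a%:P).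
Proof.
elim: n => // n IH.
by rewrite !derivnS IH deriv_comp derivD derivX derivC addr0 mulr1.
Qed.

(* At the first coefficient of [p] that does not vanish, only the top order
   term of the differential equation contributes to the lowest coefficient. *)
Lemma lin_ode_sol_eq0 e (b : nat -> {poly F}) p :
    (b e)`_0 != 0 -> \sum_(i < e.+1) b i * p^`(i) = 0 ->
    (forall i, (i < e)%N -> p`_i = 0) -> p = 0.
Proof.
move=> be0 ode init; apply/polyP => n; rewrite coef0.
elim/ltn_ind: n => n IHn; case: (ltnP n e) => [/init //|le_en].
have /(congr1 (fun q : {poly F} => q`_(n - e))) := ode.
rewrite coef0 coef_sum big_ord_recr /= big1 ?add0r => [|i _]; last first.
  rewrite coefM big1 // => j _; rewrite coef_derivn IHn ?mul0rn ?mulr0 //.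
  have := ltn_ord i; have := ltn_ord j; lia.
rewrite coefM big_ord_recl big1 ?addr0 => [|j _]; last first.
  rewrite coef_derivn IHn ?mul0rn ?mulr0 //= /bump /=.
  have := ltn_ord j; lia.
move/eqP; rewrite subn0 coef_derivn subnKC // mulf_eq0 (negPf be0) /=.
by rewrite -mulr_natr mulf_eq0 pnatr_eq0 -leqn0 leqNgt ffact_gt0 le_en orbF => /eqP.
Qed.

Lemma nonroot_exists p : p != 0 -> exists a, p.[a] != 0.
Proof. by move/closed_nonrootP => [a]; rewrite rootE; exists a. Qed.

(** A left kernel vector [b] is a linear differential equation of order [e < d] with polynomial
    coefficients, solved by all [p j]. At a point where the leading coefficient is nonzero, [e]
    initial values determine a solution, so some nontrivial combination of the [d] solutions
    vanishes. *)
Lemma wronskian_neq0 d (p : 'I_d -> {poly F}) :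
  lin_indep p -> \det (wronskian_mx p) != 0.
Proof.
move=> indep; apply/negP => /det0P [b b_neq0 bW].
have [e be_neq0 b_gt_e] : exists2 e : 'I_d, b 0 e != 0 &
    forall i : 'I_d, (e < i)%N -> b 0 i = 0.
  have [i0 bi0] : exists i, b 0 i != 0.
    apply/existsP; apply: contraNT b_neq0 => /existsPn b0.
    by apply/eqP/rowP => i; rewrite mxE; apply/eqP; rewrite -[_ == _]negbK b0.
  case: (@arg_maxnP _ i0 (fun i => b 0 i != 0) (@nat_of_ord d) bi0) => e be maxe.
  exists e => // i lt_ei; apply/eqP; apply: contraTT lt_ei => /maxe.
  by rewrite -leqNgt.
have [a bea] := nonroot_exists be_neq0.
(* Composing with [t] turns Taylor coefficients at [a] into ordinary coefficients. *)
pose t := 'X + a%:P : {poly F}.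
have size_t : size t = 2 by rewrite size_XaddC.
(* The initial data of the [d] solutions, padded with zero columns to a square matrix; column [e] is
   zero, so the matrix is singular. *)
pose M : 'M[F]_d := \matrix_(j, i) (if (i < e)%N then (p j \Po t)`_i else 0).
have /det0P [c c_neq0 cM] : \det M == 0.
  by rewrite (expand_det_col _ e) big1 // => j _; rewrite mxE ltnn mul0r.
pose q := \sum_j c 0 j *: p j.
have qt0 : q \Po t = 0.
  have qtE : q \Po t = \sum_j c 0 j *: (p j \Po t).
    by rewrite raddf_sum; apply: eq_bigr => j _; rewrite /= comp_polyZ.
  pose b' i := if insub i is Some i' then b 0 i' \Po t else 0.
  apply: (@lin_ode_sol_eq0 e b').
  - rewrite /b' insubT //= => lt_ed.
    rewrite -horner_coef0 horner_comp /t !hornerE.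
    by rewrite (_ : Sub _ _ = e) //; apply: val_inj.
  - have Lp j : \sum_(i < e.+1) b' i * (p j \Po t)^`(i) = 0.
      have /rowP/(_ j)/(congr1 (fun r => r \Po t)) := bW.
      rewrite !mxE comp_poly0 raddf_sum /= => bWj; rewrite -[RHS]bWj.
      rewrite (big_ord_widen d (fun i => b' i * (p j \Po t)^`(i))) ?ltn_ord //.
      rewrite big_mkcond /=; apply: eq_bigr => i _; rewrite mxE comp_polyM.
      rewrite /b' valK derivn_comp_XaddC ltnS; case: leqP => // /b_gt_e ->.
      by rewrite comp_poly0 mul0r.
    under eq_bigr do rewrite qtE linear_sum /= mulr_sumr.
    rewrite exchange_big big1 // => j _ /=.
    under eq_bigr do rewrite derivnZ -scalerAr.
    by rewrite -scaler_sumr Lp scaler0.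
  - move=> i lt_ie; have lt_id := ltn_trans lt_ie (ltn_ord e).
    have /rowP/(_ (Ordinal lt_id)) := cM; rewrite !mxE qtE coef_sum => cMi; rewrite -[RHS]cMi.
    by apply: eq_bigr => j _; rewrite mxE /= lt_ie coefZ.
have q0 : q = 0 by apply/eqP; rewrite -(comp_poly2_eq0 _ size_t) qt0.
case/eqP: c_neq0; apply/rowP => j; rewrite mxE.
exact: (indep (fun j => c 0 j)).
Qed.

End Wronskian.

Lemma sum_delta (V : nmodType) (I : finType) (j : I) (f : I -> V) :
  \sum_i f i *+ (i == j) = f j.
Proof.
by rewrite (bigD1 j) //= eqxx big1 ?addr0 // => i /negPf ->.
Qed.

(** * Powers of distinct monic polynomials *)

Section PowerIndependence.
Variable F : numClosedFieldType.
Implicit Types p q H w : {poly F}.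

(** Each term of the Leibniz expansion contains one entry from every column. *)
Lemma dvdp_prod_det n (M : 'M[{poly F}]_n) (q : 'I_n -> {poly F}) :
  (forall i j, q j %| M i j) -> \prod_j q j %| \det M.
Proof.
move=> qM; apply: (big_ind (fun r => \prod_j q j %| r)) => [|r1 r2|s _].
- exact: dvdp0.
- exact: dvdp_add.
apply: dvdp_mull; rewrite (reindex_inj (@perm_inj _ s)) /=.
by apply: (big_ind2 (fun r1 r2 : {poly F} => r1 %| r2)) => // r1 r2 r3 r4; apply: dvdp_mul.
Qed.

Lemma size_prod_le (I : finType) (P : I -> {poly F}) (D : I -> nat) :
  (forall i, (size (P i) <= (D i).+1)%N) -> (size (\prod_i P i)%R <= (\sum_i D i).+1)%N.
Proof.
move=> PD; apply: (big_ind2 (fun (r : {poly F}) n => (size r <= n.+1)%N)) => // [|p m q n pm qn].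
  by rewrite size_poly1.
apply: leq_trans (size_polyMleq p q) _; lia.
Qed.

Lemma size_det_le n (M : 'M[{poly F}]_n) (D : 'I_n -> nat) :
  (forall i j, (size (M i j) <= (D j).+1)%N) -> (size (\det M) <= (\sum_j D j).+1)%N.
Proof.
move=> MD; apply: leq_trans (size_sum _ _ _) _; apply/bigmax_leqP => s _.
apply: leq_trans (size_polyMleq _ _) _.
have -> : size ((-1) ^+ s : {poly F}) = 1.
  by case: (odd_perm s); rewrite ?expr0 ?expr1 ?size_polyN size_poly1.
rewrite add1n /= [X in (_ <= X.+1)%N](reindex_inj (@perm_inj _ s)) /=.
by apply: size_prod_le => i.
Qed.

Lemma dvdp_derivn_exp p q n i : p ^+ n %| q -> p ^+ (n - i) %| q^`(i).
Proof.
elim: i => [|i IHi] pq; first by rewrite subn0.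
have {IHi pq} := IHi pq; rewrite derivnS subnS.
case: (n - i)%N => [|m] /=; first by rewrite expr0 !dvd1p.
case/dvdpP => r ->; rewrite derivM deriv_exp /=; apply: dvdp_add.
  by rewrite exprS mulrA dvdp_mulIr.
by rewrite -mulrnAl mulrA dvdp_mulIr.
Qed.

Lemma size_derivn_le p i : (size p^`(i) <= size p)%N.
Proof.
elim: i => // i IHi; rewrite derivnS.
have [-> | nz] := eqVneq p^`(i) 0; first by rewrite deriv0 size_poly0.
exact: leq_trans (ltnW (lt_size_deriv nz)) IHi.
Qed.

(** [H] divides [w] times the gcd of the [qs], and over an algebraically closed field that gcd is a
    nonzero constant. *)
Lemma dvdp_no_common_root H w (qs : seq {poly F}) :
    (forall q, q \in qs -> H %| w * q) ->
    (forall a, exists2 q, q \in qs & ~~ root q a) ->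
  H %| w.
Proof.
move=> Hwq noroot; pose g := foldr (fun q g => gcdp q g) 0 qs.
have g_dvd q : q \in qs -> g %| q.
  rewrite {}/g; elim: qs {Hwq noroot} => //= q1 qs IH; rewrite inE => /orP [/eqP ->|/IH].
    exact: dvdp_gcdl.
  by apply: dvdp_trans; apply: dvdp_gcdr.
have Hwg : H %| w * g.
  rewrite {}/g in g_dvd *; elim: qs Hwq {noroot g_dvd} => /= [_|q qs IH Hwq]; first by rewrite mulr0 dvdp0.
  rewrite -(eqp_dvdr _ (gcdp_mul2l w q _)) dvdp_gcd Hwq ?mem_head //=.
  by apply: IH => r r_qs; rewrite Hwq // inE r_qs orbT.
have /size_poly1P [c c_neq0 gE] : size g == 1.
  apply/negPn/negP => /closed_rootP [a ga].
  have [q q_qs] := noroot a; case/negP; rewrite root_factor_theorem.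
  by apply: dvdp_trans (g_dvd q q_qs); rewrite -root_factor_theorem.
by move: Hwg; rewrite gE mulrC mul_polyC dvdpZr.
Qed.

(* Border the derivative matrix by a row orthogonal to [c]: the result is
   singular, and its expansion along that row compares two minors. *)
Lemma minors_proportional d (P : 'I_d.+1 -> {poly F}) (c : 'I_d.+1 -> F)
    (w := fun j => \det (wronskian_mx (fun l => P (lift j l)))) :
    \sum_j c j *: P j = 0 ->
  forall j l : 'I_d.+1, c l *: ((-1) ^+ j * w j) = c j *: ((-1) ^+ l * w l).
Proof.
move=> rel j l.
have [/eqfunP c0 | c_neq0] := boolP [forall i, c i == 0]; first by rewrite !c0 !scale0r.
(* The bordering row is orthogonal to [c] because [c l * c j - c j * c l = 0], and it selects the
   minors [j] and [l]. *)
pose y i := (c l *+ (i == j) - c j *+ (i == l))%:P.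
pose B : 'M[{poly F}]_d.+1 :=
  \matrix_(i, i') if unlift ord0 i is Some i0 then (P i')^`(i0) else y i'.
have cofB i : cofactor B ord0 i = (-1) ^+ i * w i.
  rewrite /cofactor add0n; congr (_ * \det _); apply/matrixP => i0 l0.
  by rewrite !mxE liftK.
have : \det B = 0.
  apply/eqP; rewrite -det_tr; apply/det0P; exists (\row_i (c i)%:P).
    apply: contra c_neq0 => /eqP/rowP c0; apply/forallP => i.
    by have := c0 i; rewrite !mxE => /eqP; rewrite polyC_eq0.
  apply/rowP => i; rewrite !mxE; case E: (unlift ord0 i) => [i0|].
    have /(congr1 (fun p : {poly F} => p^`(i0))) := rel.
    rewrite linear_sum /= linear0 => relD; rewrite -[RHS]relD.
    by apply: eq_bigr => i' _; rewrite !mxE E derivnZ mul_polyC.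
  under eq_bigr do rewrite !mxE E -polyCM mulrBr !mulrnAr.
  by rewrite -raddf_sum /= sumrB !sum_delta mulrC subrr.
rewrite (expand_det_row _ ord0) (eq_bigr (fun i : 'I_d.+1 =>
    (c l *: ((-1) ^+ i * w i)) *+ (i == j) - (c j *: ((-1) ^+ i * w i)) *+ (i == l))).
  by rewrite sumrB !sum_delta => /eqP; rewrite subr_eq0 => /eqP.
move=> i _; rewrite cofB mxE unlift_none /y mul_polyC scalerBl.
by rewrite -!scalerMnl.
Qed.


(* Up to units the Wronskian [w j] does not depend on [j], so it is divisible by
   [p_1^e ... p_m^e / p_l^e] for every [l], hence by [p_1^e ... p_m^e] since the
   [p_l] have no common root; for [p_j] of largest degree this contradicts the
   degree bound for [w j]. *)
Lemma power_relation_no_root d (p : 'I_d.+2 -> {poly F}) (c : 'I_d.+2 -> F) k :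
    injective p -> (forall i, p i \is monic) -> (d * d.+2 < k)%N ->
    (forall p' : 'I_d.+1 -> {poly F}, injective p' -> (forall i, p' i \is monic) ->
       lin_indep (fun i => p' i ^+ k)) ->
    (forall i, c i != 0) -> (forall a, exists i, ~~ root (p i) a) ->
  \sum_i c i *: p i ^+ k != 0.
Proof.
move=> p_inj p_monic d_lt_k indep c_neq0 noroot; apply/negP => /eqP rel.
pose w j := \det (wronskian_mx (fun l => p (lift j l) ^+ k)).
have w_neq0 j : w j != 0.
  by apply: wronskian_neq0; apply: indep => // i1 i2 /p_inj /lift_inj.
have w_dvd j l : w l %| w j.
  have := minors_proportional rel j l.
  rewrite -/(w j) -/(w l) => E.
  rewrite -[w j](signrMK j) dvdp_mull // -(dvdpZr _ _ (c_neq0 l)) E.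
  by rewrite dvdpZr // dvdp_mulIr.
pose e := (k - d)%N; pose D j := (size (p j)).-1.
have w_col j : \prod_l p (lift j l) ^+ e %| w j.
  apply: dvdp_prod_det => i l; rewrite mxE.
  apply: dvdp_trans (dvdp_derivn_exp i (dvdpp _)); apply: dvdp_exp2l.
  by rewrite /e; have := ltn_ord i; lia.
have size_pk j n : size (p j ^+ n) = (n * D j).+1.
  have := size_exp (p j) n; have := monic_neq0 (monic_exp n (p_monic j)).
  by rewrite -size_poly_gt0 mulnC /D => + <-; case: (size _).
have [j _ maxD] := @arg_maxnP _ ord0 predT D isT.
pose H := \prod_l p l ^+ e.
have H_dvd : H %| w j.
  apply: (@dvdp_no_common_root _ _ [seq p l ^+ e | l <- enum 'I_d.+2]) => [q|a].
    case/mapP => l _ ->; rewrite /H (bigD1_ord l) //= mulrC dvdp_mul2r.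
      exact: dvdp_trans (w_col l) (w_dvd j l).
    by rewrite expf_neq0 // monic_neq0.
  have [l pla] := noroot a; exists (p l ^+ e); first by rewrite (map_f (fun l => p l ^+ e)) ?mem_enum.
  by apply: contra pla; rewrite /root horner_exp expf_eq0 => /andP [].
have size_H : size H = (e * \sum_l D l).+1.
  rewrite size_prod => [|l _]; last by rewrite expf_neq0 // monic_neq0.
  under eq_bigr do rewrite size_pk -addn1.
  by rewrite big_split /= sum1_card -big_distrr /= -addSn addnK.
have size_w : (size (w j) <= (k * \sum_l D (lift j l)).+1)%N.
  rewrite big_distrr /=; apply: size_det_le => i l; rewrite mxE -size_pk.
  exact: size_derivn_le.
have := leq_trans (dvdp_leq (w_neq0 j) H_dvd) size_w.
rewrite size_H (bigD1_ord j) //= ltnS => le_deg.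
have : (\sum_l D (lift j l) <= d.+1 * D j)%N.
  rewrite -[d.+1 in leqRHS]card_ord -sum_nat_const; apply: leq_sum => l _.
  exact: (maxD (lift j l) isT).
move: le_deg; set R := (\sum_l _)%N => le_deg le_R.
(* Since [e = k - d], the bound [le_deg] gives [(k - d) D j <= d R], and [R <= (d + 1) D j]; a
   positive [D j] would force [k <= d (d + 2)]. *)
have Dj0 : D j = 0%N.
  have [//|Dj_gt0] := posnP (D j); suff : (k <= d * d.+2)%N by rewrite leqNgt d_lt_k.
  rewrite -(leq_pmul2r Dj_gt0); move: le_deg le_R; rewrite /e; nia.
have p1 l : p l = 1.
  have : (D l <= 0)%N by rewrite -Dj0; exact: (maxD _ isT).
  rewrite leqn0 /D => /eqP Dl0; have := monicP (p_monic l).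
  rewrite lead_coefE -/(D l) /D Dl0 => lc1.
  have /size1_polyC -> : (size (p l) <= 1)%N by move: Dl0; case: (size _) => [|[]].
  by rewrite lc1.
have /p_inj/eqP := etrans (p1 ord0) (esym (p1 ord_max)).
by rewrite -val_eqE.
Qed.

(** Induction on the total size: a common root [a] is removed by factoring [('X - a%:P) ^+ k] out of
    the sum, until [power_relation_no_root] applies. *)
Lemma power_lin_indep_step d k :
    (d * d.+2 < k)%N ->
    (forall p' : 'I_d.+1 -> {poly F}, injective p' -> (forall i, p' i \is monic) ->
       lin_indep (fun i => p' i ^+ k)) ->
  forall (p : 'I_d.+2 -> {poly F}) (c : 'I_d.+2 -> F),
    injective p -> (forall i, p i \is monic) -> (forall i, c i != 0) ->
  \sum_i c i *: p i ^+ k != 0.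
Proof.
move=> d_lt_k indep p c; have [n le_n] := ubnP (\sum_i size (p i))%N.
elim: n => // n IHn in p le_n * => p_inj p_monic c_neq0.
have [[a pa0]|noroot] := pselect (exists a, forall i, root (p i) a); last first.
  apply: power_relation_no_root => // a; apply/existsP; apply/existsPn => pa.
  by apply: noroot; exists a => i; have := pa i; rewrite negbK.
pose q i := p i %/ ('X - a%:P).
have pE i : p i = q i * ('X - a%:P) by rewrite divpK -?root_factor_theorem.
have q_monic i : q i \is monic.
  by have := p_monic i; rewrite pE monicMr ?monicXsubC.
have -> : \sum_i c i *: p i ^+ k = (\sum_i c i *: q i ^+ k) * ('X - a%:P) ^+ k.
  by rewrite mulr_suml; apply: eq_bigr => i _; rewrite {1}pE exprMn scalerAl.
rewrite mulf_neq0 ?expf_neq0 ?polyXsubC_eq0 //; apply: IHn => //.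
  have sizep : (\sum_i size (p i) = \sum_i size (q i) + d.+2)%N.
    transitivity (\sum_i (size (q i) + 1))%N; last by rewrite big_split sum1_card card_ord.
    apply: eq_bigr => i _.
    by rewrite {1}pE size_Mmonic ?monicXsubC ?monic_neq0 // size_XsubC addn2 addn1.
  by move: le_n; rewrite sizep ltnS addnS; apply: leq_ltn_trans (leq_addr _ _).
by move=> i1 i2 q12; apply: p_inj; rewrite pE q12 -pE.
Qed.

(** Induction on [d]: a zero coefficient shortens the relation, and a relation with all coefficients
    nonzero is excluded by the previous lemma. *)
Theorem power_lin_indep d k (p : 'I_d -> {poly F}) :
    injective p -> (forall i, p i \is monic) -> (d * d < k)%N ->
  lin_indep (fun i => p i ^+ k).
Proof.
elim: d p => [|d IHd] p p_inj p_monic d_lt_k c rel j; first by case: j.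
apply/eqP/negP => /negP cj_neq0.
have IH (p' : 'I_d -> {poly F}) : injective p' -> (forall i, p' i \is monic) -> lin_indep (fun i => p' i ^+ k).
  by move=> ? ?; apply: IHd => //; apply: leq_ltn_trans d_lt_k; rewrite leq_mul.
have [/forallP c_neq0|/existsP [l]] := boolP [forall i, c i != 0]; last first.
  rewrite negbK => /eqP cl0; move: rel; rewrite (bigD1_ord l) //= cl0 scale0r add0r.
  move=> /IH c_lift; case: (unliftP l j) cj_neq0 => [i ->|->]; last by rewrite cl0 eqxx.
  by rewrite c_lift ?eqxx // => i1 i2 /p_inj /lift_inj.
case: d => [|d] in p p_inj p_monic d_lt_k c rel j IHd IH cj_neq0 c_neq0 *.
  move/eqP: rel; rewrite big_ord1 scaler_eq0 (negPf (c_neq0 _)) /=.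
  by apply/negP; rewrite expf_neq0 ?monic_neq0.
move/eqP: rel; apply/negP; apply: power_lin_indep_step => //.
by apply: leq_ltn_trans d_lt_k; rewrite leq_mul // leqW.
Qed.

(** The family may have repetitions: equal polynomials are grouped, and independence of the distinct
    ones kills the total coefficient of each group. *)
Lemma power_relation_fibre (I : finType) (p : I -> {poly F}) (c : I -> F) k :
    (forall i, p i \is monic) -> (#|I| * #|I| < k)%N ->
    \sum_i c i *: p i ^+ k = 0 ->
  forall q, \sum_(i | p i == q) c i = 0.
Proof.
move=> p_monic I_lt_k rel q.
pose u := undup (codom p); pose P (j : 'I_(size u)) := u`_j.
have P_in j : P j \in codom p by rewrite -mem_undup mem_nth.
have P_inj : injective P.
  by move=> i j /eqP; rewrite nth_uniq ?undup_uniq // => /eqP/val_inj.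
have u_lt_k : (size u * size u < k)%N.
  by apply: leq_ltn_trans I_lt_k; rewrite leq_mul // (leq_trans (size_undup _)) ?size_codom.
have P_monic j : P j \is monic by have /codomP [i ->] := P_in j.
have c0 := power_lin_indep P_inj P_monic u_lt_k (c := fun j => \sum_(i | p i == P j) c i).
have [/codomP [i0 ->]|q_notin] := boolP (q \in codom p); last first.
  by rewrite big1 // => i /eqP pi; case/negP: q_notin; rewrite -pi codom_f.
have iu i : (index (p i) u < size u)%N by rewrite index_mem mem_undup codom_f.
have PE i : P (Ordinal (iu i)) = p i by rewrite /P nth_index // mem_undup codom_f.
rewrite -PE; apply: c0; rewrite -[RHS]rel.
rewrite (partition_big (fun i => Ordinal (iu i)) predT) //=; apply: eq_bigr => j _.
rewrite scaler_suml; apply: eq_big => [i|i /eqP <- //].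
by rewrite -(inj_eq P_inj) PE.
Qed.

End PowerIndependence.

(** * Linear equations in a group with only formal relations *)

Section FormalRelations.
Variables (K : fieldType) (G : K -> Prop) (N : nat).
Hypothesis G1 : G 1.
Hypothesis GM : forall x y, G x -> G y -> G (x * y).
Hypothesis G_neq0 : forall x, G x -> x != 0.
(** For the k-th powers of monic fractions this will be [kth_power_formal]. *)
Hypothesis G_formal : forall (I : finType) (c : I -> int) (g : I -> K),
  (#|I| <= N)%N -> (forall i, G (g i)) -> \sum_i (c i)%:~R * g i = 0 ->
  forall h, \sum_(i | g i == h) c i = 0.

(** Each label class is a union of fibres of [g], and each fibre contributes zero. *)
Lemma G_formal_split (I T : finType) (c : I -> int) (g : I -> K) (l : I -> T) :
    (#|I| <= N)%N -> (forall i, G (g i)) -> \sum_i (c i)%:~R * g i = 0 ->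
    (forall i j, g i = g j -> l i = l j) ->
  forall t, \sum_(i | l i == t) (c i)%:~R * g i = 0.
Proof.
move=> I_le_N Gg rel gl t.
(* A chosen index in each fibre of [g], so that the sum is partitioned over the finite type [I]
   instead of over [K]. *)
pose rep i := odflt i [pick j | g j == g i].
have g_rep i : g (rep i) = g i by rewrite /rep; case: pickP => //= j /eqP.
have rep_eq i j : g i = g j -> rep i = rep j.
  move=> gij; rewrite /rep (eq_pick (_ : _ =1 (fun l => g l == g j))) => [|l0]; last by rewrite gij.
  by case: pickP => // /(_ j); rewrite eqxx.
rewrite (partition_big rep predT) //= big1 // => j _.
have [i0 /andP [/eqP li0 /eqP ri0]|none] := pickP (fun i => (l i == t) && (rep i == j)); last first.
  by rewrite big_pred0.
rewrite (eq_bigl (fun i => g i == g j)) => [|i]; last first.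
  apply/andP/eqP => [[_ /eqP <-]|gij]; first by rewrite g_rep.
  have gi0 : g i = g i0 by rewrite gij -ri0 g_rep.
  by rewrite (gl _ _ gi0) li0 (rep_eq _ _ gi0) ri0.
transitivity ((\sum_(i | g i == g j) c i)%:~R * g j); last by rewrite G_formal ?mul0r.
by rewrite rmorph_sum mulr_suml; apply: eq_bigr => i /eqP ->.
Qed.

Lemma G_prod (I : finType) (P : pred I) (g : I -> K) : (forall i, G (g i)) -> G (\prod_(i | P i) g i).
Proof. by move=> Gg; apply: (big_ind G). Qed.

Section Minors.
Variables (I : finType) (J : {set I}) (X : {ffun I -> K} -> Prop) (a : I -> K).
Hypothesis XG : forall x, X x -> forall i, G (x i).
Hypothesis Xrel : forall x, X x -> \sum_(i in J) a i * x i = 0.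
Hypothesis a_neq0 : exists2 j, j \in J & a j != 0.

(** Minors of the possibly infinite matrix whose rows are the solutions in [X]. That the columns are
    distinct follows from nonvanishing. *)
Definition nonzero_minor r : Prop :=
  exists (f : 'I_r -> {ffun I -> K}) (g : 'I_r -> I),
    [/\ forall i, X (f i), forall l, g l \in J & \det (\matrix_(i, l) f i (g l)) != 0].

Lemma minor_cols_inj r (f : 'I_r -> {ffun I -> K}) (g : 'I_r -> I) :
  \det (\matrix_(i, l) f i (g l)) != 0 -> injective g.
Proof.
move=> det_neq0 l1 l2 gl; apply/eqP; apply: contraNT det_neq0 => l12.
rewrite -det_tr (determinant_alternate l12) // => i.
by rewrite !mxE gl.
Qed.

(** If the columns exhausted [J], the coefficients [a] would be a nonzero kernel vector. *)
Lemma minor_cols_incomplete r (f : 'I_r -> {ffun I -> K}) (g : 'I_r -> I) :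
    (forall i, X (f i)) -> (forall l, g l \in J) ->
    \det (\matrix_(i, l) f i (g l)) != 0 ->
  exists2 j, j \in J & forall l, g l != j.
Proof.
move=> Xf gJ det_neq0; have g_inj := minor_cols_inj det_neq0.
have [/existsP [j /andP [jJ /forallP gj]]|/existsPn none] :=
  boolP [exists j, (j \in J) && [forall l, g l != j]]; first by exists j.
case/negP: det_neq0; rewrite -det_tr.
have J_img j : j \in J -> exists l, j = g l.
  move=> jJ; have := none j; rewrite jJ /= => /forallPn [l]; rewrite negbK => /eqP <-.
  by exists l.
have JE : J = [set g l | l in [set: 'I_r]].
  apply/setP => j; apply/idP/imsetP => [/J_img [l ->]|[l _ ->] //]; by exists l.
apply/det0P; exists (\row_l a (g l)).
  have [j /J_img [l ->] agl] := a_neq0.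
  by apply: contra agl => /eqP/rowP/(_ l); rewrite !mxE => ->.
apply/rowP => i; rewrite !mxE -[RHS](Xrel (Xf i)).
rewrite [in RHS]JE big_imset /=; last by move=> ? ? _ _; apply: g_inj.
by apply: eq_big => [l|l _]; rewrite ?inE // !mxE.
Qed.

Lemma maximal_minor : exists2 r, nonzero_minor r & ~ nonzero_minor r.+1.
Proof.
apply: contrapT => no_max.
have all_minors r : nonzero_minor r.
  elim: r => [|r IHr]; last by apply: contrapT => nr; apply: no_max; exists r.
  have [j _ _] := a_neq0; exists (fun=> [ffun => 0]), (fun=> j).
  by split=> [[]|[]|] //; rewrite det_mx00 oner_neq0.
have [f [g [_ _ /minor_cols_inj g_inj]]] := all_minors #|I|.+1.
have := leq_card g g_inj; by rewrite card_ord ltnn.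
Qed.

(* Bordering a maximal nonzero minor by a solution [x] gives a vanishing
   determinant. Its monomials lie in [G], so they cancel formally; as the minor
   is nonzero, two monomials involving distinct coordinates of [x] coincide. *)
Lemma finite_ratio : (#|I| `! <= N)%N ->
  exists2 L : seq K, (size L <= N * N)%N &
    forall x, X x -> exists i j, [/\ i \in J, j \in J, i != j & x i / x j \in L].
Proof.
move=> I_le_N.
have [r [f [g [Xf gJ det_neq0]]] max_r] := maximal_minor.
have [j jJ gj] := minor_cols_incomplete Xf gJ det_neq0.
have g_inj := minor_cols_inj det_neq0.
(* The new column [j] takes position 0, like the new row [x] in [f'] below. *)
pose g' l := if unlift ord0 l is Some l' then g l' else j.
have g'_inj : injective g'.
  move=> l1 l2; rewrite /g'; case: unliftP => [l1' ->|->]; case: unliftP => [l2' ->|->] //.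
  - by move=> /g_inj ->.
  - by move/eqP; rewrite (negPf (gj _)).
  - by move/esym/eqP; rewrite (negPf (gj _)).
have g'J l : g' l \in J by rewrite /g'; case: unlift.
have card_S : (#|{: 'S_r.+1}| <= N)%N.
  apply: leq_trans I_le_N; rewrite card_Sn; apply: leq_fact.
  by have := leq_card g' g'_inj; rewrite card_ord.
pose mono (s : 'S_r.+1) := \prod_i f i (g' (s (lift ord0 i))).
have mono_neq0 s : mono s != 0 by apply/G_neq0/G_prod => i; apply: XG.
(* Only the fixed rows [f] enter these ratios, so the list is independent of [x]. *)
exists [seq mono t / mono s | s <- enum 'S_r.+1, t <- enum 'S_r.+1].
  by rewrite size_allpairs -cardE leq_mul.
move=> x Xx; apply: contrapT => no_ratio.
have x_neq0 i : x i != 0 by apply/G_neq0/XG.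
pose f' i := if unlift ord0 i is Some i' then f i' else x.
have Xf' i : X (f' i) by rewrite /f'; case: unlift.
pose M : 'M[K]_r.+1 := \matrix_(i, l) f' i (g' l).
have detM : \det M = 0.
  by apply/eqP/negPn/negP => ?; apply: max_r; exists f', g'.
pose term (s : 'S_r.+1) := \prod_i M i (s i).
have termE s : term s = x (g' (s ord0)) * mono s.
  rewrite /term big_ord_recl mxE /f' unlift_none; congr (_ * _).
  by apply: eq_bigr => i _; rewrite mxE /f' liftK.
have Gterm s : G (term s) by apply: G_prod => i; rewrite mxE; apply: XG.
have term_split (s t : 'S_r.+1) : term s = term t -> s ord0 = t ord0.
  rewrite !termE => st; apply: g'_inj; apply/eqP; apply: contrapT => /negP ne.
  apply: no_ratio; exists (g' (s ord0)), (g' (t ord0)); split => //.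
  apply/allpairsP; exists (s, t); split; rewrite ?mem_enum //=.
  by apply/eqP; rewrite eqr_div // st mulrC.
have rel : \sum_(s : 'S_r.+1) ((-1) ^+ s : int)%:~R * term s = 0.
  rewrite -[RHS]detM; apply: eq_bigr => s _.
  by rewrite rmorphXn /= rmorphN1.
(* Labelling a permutation by its image of 0 isolates the terms containing [x j]; their sum is [x j]
   times, up to sign, the nonzero minor, yet it must vanish. *)
have := G_formal_split card_S Gterm rel term_split ord0; apply/eqP.
have -> : \sum_(s : 'S_r.+1 | s ord0 == ord0) ((-1) ^+ s : int)%:~R * term s
    = M ord0 ord0 * cofactor M ord0 ord0.
  rewrite expand_cofactor big_distrr /=; apply: eq_bigr => s /eqP s0.
  rewrite rmorphXn /= rmorphN1 mulrCA; congr (_ * _).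
  by rewrite /term (bigD1 ord0) //= s0; congr (_ * _); apply: eq_bigl => i; rewrite eq_sym.
rewrite mulf_neq0 //; first by rewrite mxE; apply: G_neq0; apply: XG.
rewrite /cofactor mulf_neq0 ?signr_eq0 //.
have -> : row' ord0 (col' ord0 M) = (\matrix_(i, l) f i (g l) : 'M_r) by
  apply/matrixP => i l; rewrite !mxE /f' /g' !liftK.
exact: det_neq0.
Qed.

End Minors.

Lemma size_allpairs_dep_le (T1 T2 T3 : Type) (f : T1 -> T2 -> T3) (s : seq T1)
    (t : T1 -> seq T2) n :
  (forall x, (size (t x) <= n)%N) -> (size [seq f x y | x <- s, y <- t x] <= size s * n)%N.
Proof.
move=> tn; rewrite size_allpairs_dep; elim: s => //= x s IH.
by rewrite mulSn leq_add.
Qed.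

(** Substituting [x i = r * x j] eliminates coordinate [i]. Subsums of the new equation are subsums
    of the old one, so nondegeneracy is inherited. *)
Lemma merge_columns (I : finType) (J : {set I}) (a x : I -> K) (i j : I) (r : K) :
    i \notin J -> i != j -> x i = r * x j ->
  \sum_(l in J) (if l == j then a j + a i * r else a l) * x l
    = \sum_(l in if j \in J then [set i] :|: J else J) a l * x l.
Proof.
move=> iJ ij xi; case: ifP => jJ.
  rewrite big_setU1 //= (bigD1 j) //= eqxx [in RHS](bigD1 j) //= addrA xi mulrDl mulrA.
  rewrite [a j * x j + _]addrC; congr (_ + _); apply: eq_bigr => l /andP [_ /negPf ->] //.
by apply: eq_bigr => l lJ; case: eqP lJ => [->|//]; rewrite jJ.
Qed.

(** The usual condition for unit equations: on a vanishing subsum a solution could be rescaled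
    separately, which could create infinitely many directions. *)
Definition nondegenerate (I : finType) (J : {set I}) (a : I -> K) (x : I -> K) : Prop :=
  \sum_(i in J) a i * x i = 0 /\
  forall J' : {set I}, J' \proper J -> J' != set0 -> \sum_(i in J') a i * x i != 0.

(** Induction on the size of [J]. By [finite_ratio] each solution satisfies [x i = r * x j] for one
    of boundedly many triples [(i, j, r)]; each triple eliminates one coordinate, and directions of
    the smaller equation extend back. *)
Theorem finitely_many_directions (I : finType) n (J : {set I}) (a : I -> K)
    (X : {ffun I -> K} -> Prop) :
    (#|I| `! <= N)%N -> (#|J| <= n)%N ->
    (forall x, X x -> forall i, G (x i)) ->
    (forall x : {ffun I -> K}, X x -> nondegenerate J a x) ->
  exists2 Y : seq {ffun I -> K}, (size Y <= (#|I| * #|I| * (N * N)).+1 ^ n)%N &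
    forall x, X x -> exists2 y, y \in Y & exists c, forall i, i \in J -> x i = c * y i.
Proof.
move=> I_le_N; set B := (_ * _)%N.
elim: n J a X => [|n IHn] J a X J_le XG Xnd.
  exists [:: [ffun=> 0]]; first by rewrite expn0.
  move=> x _; exists [ffun=> 0]; first exact: mem_head.
  by exists 0 => i; rewrite (cards0_eq (_ : #|J| = 0)) ?inE //; apply/eqP; rewrite -leqn0.
have [J_le1|J_gt1] := leqP #|J| 1.
  exists [:: [ffun=> 1]]; first by rewrite expn_gt0.
  move=> x _; exists [ffun=> 1]; first exact: mem_head.
  have [->|[j jJ]] := set_0Vmem J; first by exists 0 => i; rewrite inE.
  exists (x j) => i iJ; rewrite ffunE mulr1; congr (x _).
  by move/card_le1_eqP: J_le1; apply.
have [[x0 Xx0]|X0] := pselect (exists x, X x); last first.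
  by exists [::] => // x Xx; case: X0; exists x.
have [j0 j0J] : exists j, j \in J by apply/card_gt0P; apply: leq_trans J_gt1.
(* As [J] has at least two elements, the singleton [j0] is a proper subsum, hence nonzero. *)
have aj0 : a j0 != 0.
  have [_ /(_ [set j0])] := Xnd _ Xx0; rewrite properEcard sub1set j0J cards1 J_gt1.
  rewrite -card_gt0 cards1 big_set1 => /(_ isT isT); apply: contra => /eqP ->.
  by rewrite mul0r.
have Xrel x : X x -> \sum_(i in J) a i * x i = 0 by case/Xnd.
have [L L_le ratio] := finite_ratio XG Xrel (ex_intro2 _ _ j0 j0J aj0) I_le_N.
have step (t : I * I * K) : exists Y : seq {ffun I -> K}, (size Y <= B.+1 ^ n)%N /\
    (t.1.1 \in J -> t.1.2 \in J -> t.1.1 != t.1.2 -> forall x, X x -> x t.1.1 / x t.1.2 = t.2 ->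
     exists2 y, y \in Y & exists c, forall i, i \in J :\ t.1.1 -> x i = c * y i).
  case: t => [[i j] r] /=.
  have [/and3P [iJ jJ ij]|bad] := boolP [&& i \in J, j \in J & i != j]; last first.
    by exists [::]; split=> // iJ jJ ij; case/negP: bad; rewrite iJ jJ.
  pose X' x := X x /\ x i / x j = r.
  have [|x [] /XG //|x [Xx xr]|Y Y_le HY] := IHn (J :\ i)
      (fun l => if l == j then a j + a i * r else a l) X'.
  - by move: J_le; rewrite (cardsD1 i) iJ add1n ltnS.
  - have [x_sum x_nd] := Xnd _ Xx.
    have xi : x i = r * x j by rewrite -xr divfK //; apply/G_neq0/XG.
    have merge (J' : {set I}) (J'J : J' \subset J :\ i) : i \notin J'.
      by apply/negP => /(subsetP J'J); rewrite !inE eqxx.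
    split; first by rewrite (merge_columns _ (merge _ (subxx _)) ij xi) !inE eq_sym ij jJ setD1K.
    move=> J' J'J J'0; rewrite (merge_columns _ (merge _ (proper_sub J'J)) ij xi).
    have iJ' := merge _ (proper_sub J'J).
    have sub_J : [set i] :|: J' \proper J.
      by rewrite -(setD1K iJ) properEcard setUS ?proper_sub //= !cardsU1 iJ' !inE eqxx
                 ltn_add2l proper_card.
    case: ifP => _; apply: x_nd => //.
      by rewrite -card_gt0 cardsU1 iJ'.
    by apply: sub_proper_trans sub_J; apply: subsetUr.
  by exists Y; split=> // _ _ _ x Xx xr; apply: HY.
have [Yf HYf] := choice step.
pose T := [seq (ij, r) | ij <- enum {: I * I}, r <- L].
pose extend (t : I * I * K) (y : {ffun I -> K}) : {ffun I -> K} :=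
  [ffun l => if l == t.1.1 then t.2 * y t.1.2 else y l].
exists [seq extend t y | t <- T, y <- Yf t].
  apply: leq_trans (size_allpairs_dep_le _ _ (fun t => proj1 (HYf t))) _.
  rewrite expnS leq_mul2r; apply/orP; right; rewrite size_allpairs -cardE card_prod.
  by apply: leq_trans (leqnSn _); rewrite leq_mul.
move=> x Xx; have [i [j [iJ jJ ij rL]]] := ratio x Xx.
pose t := (i, j, x i / x j).
have [y yY [c xE]] := proj2 (HYf t) iJ jJ ij x Xx erefl.
exists (extend t y).
  apply/allpairsPdep; exists t, y; split=> //.
  by apply/allpairsP; exists ((i, j), x i / x j); rewrite mem_enum.
exists c => l lJ; rewrite ffunE /=; case: eqP => [->|/eqP li].
  by rewrite mulrCA -xE ?inE 1?eq_sym ?ij // divfK //; apply/G_neq0/XG.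
by rewrite xE // !inE li.
Qed.

End FormalRelations.

(** * Pluennecke's inequality *)

Section Plunnecke.
Variable A : idomainType.
Implicit Types X Y Z S C : {fset A}.

Definition mulset X Y : {fset A} := [fset x * y | x in X, y in Y].

Lemma mulsetP X Y z :
  reflect (exists x y, [/\ x \in X, y \in Y & z = x * y]) (z \in mulset X Y).
Proof.
apply: (iffP (imfset2P _ _ _ _ _)) => [[x xX [y yY ->]]|[x [y [xX yY ->]]]].
  by exists x, y.
by exists x => //; exists y.
Qed.

Lemma mem_mulset X Y x y : x \in X -> y \in Y -> x * y \in mulset X Y.
Proof. by move=> xX yY; apply/mulsetP; exists x, y. Qed.

Lemma mulsetA X Y Z : mulset X (mulset Y Z) = mulset (mulset X Y) Z.
Proof.
apply/fsetP => t; apply/mulsetP/mulsetP.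
  move=> [x [_ [xX /mulsetP [y [z [yY zZ ->]]] ->]]].
  by exists (x * y), z; rewrite mulrA mem_mulset.
move=> [_ [z [/mulsetP [x [y [xX yY ->]]] zZ ->]]].
by exists x, (y * z); rewrite mulrA mem_mulset.
Qed.

Lemma mulset0 X : mulset X fset0 = fset0.
Proof. by apply/fsetP => t; rewrite inE; apply/negP => /mulsetP [x [y [_]]]; rewrite inE. Qed.

Lemma card_mulset_le X x Y : x != 0 -> x \in X -> (#|` Y| <= #|` mulset X Y|)%N.
Proof.
move=> x0 xX.
have <- : #|` [fset x * y | y in Y]| = #|` Y| by rewrite card_imfset //; apply: mulfI.
apply: fsubset_leq_card.
by apply/fsubsetP => _ /imfsetP [y yY ->]; apply: mem_mulset.
Qed.

(** Induction on [C], adding one element [g]. With [Z] the set of [x] whose products [x S g] are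
    already covered, the left product gains at most [|XS| - |ZS|] elements and [X C] gains at least
    [|X| - |Z|]; minimality of the ratio at [X] compares the two. *)
Lemma petridis X S C :
    0 \notin C ->
    (forall Z, Z `<=` X -> (#|` mulset X S| * #|` Z| <= #|` mulset Z S| * #|` X|)%N) ->
  (#|` mulset (mulset X S) C| * #|` X| <= #|` mulset X S| * #|` mulset X C|)%N.
Proof.
move=> C0 minX; elim/finSet_rect: C C0 => C IH C0.
have [->|[g gC]] := fset_0Vmem C; first by rewrite !mulset0 !cardfs0 muln0.
have g0 : g != 0 by apply: contraNneq C0 => <-.
pose C1 := C `\ g.
have {}IH : (#|` mulset (mulset X S) C1| * #|` X| <= #|` mulset X S| * #|` mulset X C1|)%N.
  by apply: IH; rewrite ?fproperD1 // !inE negb_and C0 orbT.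
pose Z := [fset x in X | [fset (x * s) * g | s in S] `<=` mulset (mulset X S) C1].
have ZX : Z `<=` X by apply/fsubsetP => x; rewrite !inE => /andP [].
have cardg (Y : {fset A}) : #|` [fset y * g | y in Y]| = #|` Y| by rewrite card_imfset //; apply: mulIf.
have ZSX : mulset Z S `<=` mulset X S.
  by apply/fsubsetP => _ /mulsetP [x [s [/(fsubsetP ZX) xX sS ->]]]; apply: mem_mulset.
have upper : (#|` mulset (mulset X S) C| + #|` mulset Z S|
    <= #|` mulset (mulset X S) C1| + #|` mulset X S|)%N.
  rewrite -(subnK (fsubset_leq_card ZSX)) addnA leq_add2r -cardfsDS // -(cardg (_ `\` _)).
  set W := [fset _ | _ in _ `\` _].
  have WE : (#|` mulset (mulset X S) C1 `|` W| <= #|` mulset (mulset X S) C1| + #|` W|)%N.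
    by rewrite cardfsU leq_subr.
  apply: leq_trans WE; apply/fsubset_leq_card/fsubsetP => _ /mulsetP [y [c [yXS cC ->]]]; rewrite in_fsetU.
  have [->|cg] := eqVneq c g; last first.
    by apply/orP; left; apply: mem_mulset => //; rewrite !inE cg.
  have [/mulsetP [x [s [xZ sS ->]]]|yZS] := boolP (y \in mulset Z S).
    apply/orP; left; move: xZ; rewrite !inE => /andP [_ /fsubsetP]; apply.
    by apply/imfsetP; exists s.
  by apply/orP; right; apply/imfsetP; exists y => //; rewrite !inE yZS yXS.
(* If [x g] already lies in [X C1], then [x] is in [Z]; so the translate of the complement of [Z] is
   disjoint from [X C1]. *)
have lower : (#|` mulset X C1| + #|` X| <= #|` mulset X C| + #|` Z|)%N.
  rewrite -(subnK (fsubset_leq_card ZX)) addnA leq_add2r -cardfsDS // -(cardg (_ `\` _)).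
  rewrite -cardfsUI (_ : _ `&` _ = fset0) ?cardfs0 ?addn0.
    apply/fsubset_leq_card/fsubsetP => y; rewrite in_fsetU => /orP [/mulsetP [x [c [xX]]]|].
      by rewrite !inE => /andP [_ cC] ->; apply: mem_mulset.
    by move=> /imfsetP [x /=]; rewrite !inE => /andP [_ xX] ->; apply: mem_mulset.
  apply/fsetP => y; rewrite inE [RHS]inE; apply/negP => /andP [/mulsetP [x' [c [x'X cC ->]]]].
  move=> /imfsetP [x /=]; rewrite inE => /andP [xZ xX] x'c.
  case/negP: xZ; rewrite !inE xX /=; apply/fsubsetP => _ /imfsetP [s /= sS ->].
  by rewrite mulrAC -x'c mulrAC !mem_mulset.
move: (minX Z ZX) (fsubset_leq_card ZX) upper lower IH; nia.
Qed.

Lemma min_ratio_subset S : S != fset0 -> exists X,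
  [/\ X `<=` S, X != fset0 &
   forall Z, Z `<=` S -> (#|` mulset X S| * #|` Z| <= #|` mulset Z S| * #|` X|)%N].
Proof.
move=> S0; pose f X : rat := #|` mulset X S|%:R / #|` X|%:R.
have seq_min (s : seq {fset A}) : s != [::] -> exists2 X, X \in s & {in s, forall Z, f X <= f Z}.
  elim: s => // X s IH _; have [->|/IH [Y Ys minY]] := eqVneq s [::].
    by exists X; rewrite ?mem_head // => Z; rewrite inE => /eqP ->.
  have [XY|YX] := leP (f X) (f Y).
    exists X; rewrite ?mem_head // => Z; rewrite inE => /orP [/eqP -> //|/minY].
    exact: le_trans.
  exists Y; rewrite ?inE ?Ys ?orbT // => Z; rewrite inE => /orP [/eqP ->|/minY //].
  exact: ltW.
have [|X] := seq_min [seq X <- fpowerset S | X != fset0].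
  have : S \in [seq X <- fpowerset S | X != fset0] by rewrite mem_filter S0 fpowersetE /=.
  by case: filter.
rewrite mem_filter fpowersetE => /andP [X0 XS] minX; exists X; split=> // Z ZS.
have [->|Z0] := eqVneq Z fset0; first by rewrite cardfs0 muln0.
have := minX Z; rewrite mem_filter Z0 fpowersetE ZS => /(_ isT).
rewrite /f ler_pdivrMr ?ltr0n ?cardfs_gt0 // mulrAC ler_pdivlMr ?ltr0n ?cardfs_gt0 //.
by rewrite -!natrM ler_nat.
Qed.

Fixpoint powset S m : {fset A} := if m is m'.+1 then mulset S (powset S m') else [fset 1].

Lemma powset_neq0 S m : 0 \notin S -> 0 \notin powset S m.
Proof.
move=> S0; elim: m => [|m IH] /=; first by rewrite inE eq_sym oner_eq0.
apply/mulsetP => -[x [y [xS yP /esym/eqP]]]; rewrite mulf_eq0 => /orP [] /eqP E.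
  by move: S0; rewrite -E xS.
by move: IH; rewrite -E yP.
Qed.

Lemma mem_powset S s m : s \in S -> s ^+ m \in powset S m.
Proof. by move=> sS; elim: m => [|m IH]; rewrite ?inE // exprS mem_mulset. Qed.

(* [S != fset0] is needed because [powset S 0] is [[fset 1]]. *)
Theorem plunnecke S m : 0 \notin S -> S != fset0 ->
  (#|` powset S m| * #|` S| ^ m <= #|` mulset S S| ^ m * #|` S|)%N.
Proof.
move=> S0 S_neq0.
have [X [XS X0 minX]] := min_ratio_subset S_neq0.
have /fset0Pn [x xX] := X0.
have x_neq0 : x != 0 by apply: contraNneq S0 => <-; apply: (fsubsetP XS).
have X_gt0 : (0 < #|` X|)%N by rewrite cardfs_gt0.
have minS := minX S (fsubset_refl S).
(* Each factor [S] costs at most [|XS| / |X|] by [petridis], which is at most [|SS| / |S|] by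
   minimality tested on [S] itself. *)
have growth : (#|` mulset X (powset S m)| * #|` S| ^ m <= #|` mulset S S| ^ m * #|` X|)%N.
  elim: m => [|m IH].
    rewrite !expn0 muln1 mul1n; apply/fsubset_leq_card/fsubsetP => t.
    by move=> /mulsetP [y [z [yX]]]; rewrite inE => /eqP -> ->; rewrite mulr1.
  rewrite /= mulsetA !expnS -(leq_pmul2r X_gt0).
  have step := petridis (powset_neq0 m S0) (fun Z ZX => minX Z (fsubset_trans ZX XS)).
  rewrite mulnAC; apply: leq_trans (leq_mul step (leqnn _)) _; rewrite mulnACA.
  by apply: leq_trans (leq_mul minS IH) _; rewrite mulnACA mulnA.
apply: leq_trans (leq_mul (card_mulset_le _ x_neq0 xX) (leqnn _)) _.
by apply: leq_trans growth _; rewrite leq_mul2l fsubset_leq_card ?orbT.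
Qed.

End Plunnecke.

(** * Classes modulo k-th powers and counting *)

Lemma mulr_div_common (K : fieldType) (a b r : K) : b != 0 -> a * r = (b * r) * (a / b).
Proof. by move=> b0; rewrite [RHS]mulrC mulrA divfK. Qed.

Section KthPowers.
Variables (F : numClosedFieldType) (N k : nat).
Hypothesis N_gt1 : (1 < N)%N.
Hypothesis N_lt_k : (N * N < k)%N.
Local Notation K := {fraction {poly F}}.
Local Notation "p %:K" := (FracField.tofrac p) (at level 2, format "p %:K").
Implicit Types p q : {poly F}.

(** Monic numerators and denominators exclude constants other than 1; a constant such as [2 ^ k]
    would satisfy an integer relation with 1 that does not cancel formally. *)
Definition kth_power (x : K) : Prop :=
  exists p q, [/\ p \is monic, q \is monic & x = (p ^+ k)%:K / (q ^+ k)%:K].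

Lemma monic_frac_neq0 p : p \is monic -> p%:K != 0.
Proof. by move=> pm; rewrite tofrac_eq0 monic_neq0. Qed.

Lemma kth_power1 : kth_power 1.
Proof. by exists 1, 1; rewrite monic1 expr1n divff // oner_neq0. Qed.

Lemma kth_powerM x y : kth_power x -> kth_power y -> kth_power (x * y).
Proof.
move=> [p [q [pm qm ->]]] [p' [q' [pm' qm' ->]]]; exists (p * p'), (q * q').
by split; rewrite ?monicMl // !exprMn !rmorphM /= invfM mulrACA.
Qed.

Lemma kth_powerV x : kth_power x -> kth_power x^-1.
Proof. by move=> [p [q [pm qm ->]]]; exists q, p; rewrite invf_div. Qed.

Lemma kth_power_neq0 x : kth_power x -> x != 0.
Proof.
move=> [p [q [pm qm ->]]].
by rewrite mulf_neq0 ?invr_eq0 // monic_frac_neq0 // monic_exp.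
Qed.

Lemma monic_exp_inj p q : p \is monic -> q \is monic -> p ^+ k = q ^+ k -> p = q.
Proof.
move=> pm qm pq; apply/eqP/negPn/negP => p_neq_q.
have f_monic (b : bool) : (if b then p else q) \is monic by case: b.
have rel : \sum_b (if b then 1 else -1) *: (if b then p else q) ^+ k = 0.
  by rewrite big_bool /= pq scale1r scaleN1r subrr.
have card2 : (#|{: bool}| * #|{: bool}| < k)%N.
  by rewrite card_bool; apply: leq_ltn_trans N_lt_k; rewrite leq_mul.
have /eqP := power_relation_fibre f_monic card2 rel p.
rewrite (big_pred1 true) ?oner_eq0 // => -[] /=; rewrite ?eqxx //.
by rewrite eq_sym (negPf p_neq_q).
Qed.

(** Multiplying by the k-th power of the common denominator [Q] gives a relation between k-th powers
    of the monic [P i], and [P i = P j] exactly when [g i = g j]. *)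
Lemma kth_power_formal (I : finType) (c : I -> int) (g : I -> K) :
    (#|I| <= N)%N -> (forall i, kth_power (g i)) -> \sum_i (c i)%:~R * g i = 0 ->
  forall h, \sum_(i | g i == h) c i = 0.
Proof.
move=> I_le_N /choice [p /choice [q pqE]] rel h.
have pm i : p i \is monic by case: (pqE i).
have qm i : q i \is monic by case: (pqE i).
have gE i : g i = (p i ^+ k)%:K / (q i ^+ k)%:K by case: (pqE i).
pose Q := \prod_i q i; pose P i := p i * \prod_(j | j != i) q j.
have Qm : Q \is monic by apply: monic_prod.
have Pm i : P i \is monic by rewrite monicMl // monic_prod.
have Qk_neq0 : (Q ^+ k)%:K != 0 by rewrite monic_frac_neq0 // monic_exp.
have PE i : (P i ^+ k)%:K = (Q ^+ k)%:K * g i.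
  have PkE : P i ^+ k = p i ^+ k * (\prod_(j | j != i) q j) ^+ k by apply: exprMn.
  have QkE : Q ^+ k = q i ^+ k * (\prod_(j | j != i) q j) ^+ k.
    by rewrite -exprMn /Q (bigD1 i).
  rewrite PkE QkE gE !tofracM; apply: mulr_div_common.
  by rewrite monic_frac_neq0 // monic_exp.
have rel' : \sum_i (c i)%:~R *: P i ^+ k = 0.
  apply/eqP; rewrite -tofrac_eq0 rmorph_sum /=.
  under eq_bigr do rewrite -mul_polyC rmorphM /= PE mulrCA !rmorph_int.
  by rewrite -mulr_sumr rel mulr0.
have [i0 /eqP gi0|none] := pickP (fun i => g i == h); last by rewrite big_pred0.
have I_lt_k : (#|I| * #|I| < k)%N by apply: leq_ltn_trans N_lt_k; rewrite leq_mul.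
have /eqP := power_relation_fibre Pm I_lt_k rel' (P i0).
rewrite -rmorph_sum intr_eq0 => /eqP sum0; rewrite -[RHS]sum0; apply: eq_bigl => i.
apply/eqP/eqP => [gi|PP].
  apply: monic_exp_inj => //; apply/eqP; rewrite -tofrac_eq; apply/eqP.
  by rewrite !PE gi gi0.
by apply: (mulfI Qk_neq0); rewrite -gi0 -!PE PP.
Qed.

(** Four coordinates require [4! = 24] formal terms. The bound [B] is chosen before [a], hence
    uniform in the coefficients. *)
Lemma directions : (24 <= N)%N -> exists B, forall a : 'I_4 -> K,
  exists Y : seq {ffun 'I_4 -> K}, (size Y <= B)%N /\
    forall x : {ffun 'I_4 -> K}, (forall i, kth_power (x i)) -> nondegenerate setT a x ->
      exists2 y, y \in Y & exists c, forall i, x i = c * y i.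
Proof.
move=> N_ge; exists ((#|'I_4| * #|'I_4| * (N * N)).+1 ^ 4)%N => a.
have [||x []|x []|Y Y_le HY] := @finitely_many_directions K kth_power N kth_power1 kth_powerM
    kth_power_neq0 kth_power_formal 'I_4 4 setT a
    (fun x => (forall i, kth_power (x i)) /\ nondegenerate setT a x).
- by rewrite card_ord.
- by rewrite cardsT card_ord.
- by [].
- by [].
exists Y; split=> // x xG xnd; have [|y yY [c xE]] := HY x; first by [].
by exists y => //; exists c => i; apply: xE; rewrite inE.
Qed.

Section Classes.
Variable S : {fset {poly F}}.
Hypothesis S_monic : forall s, s \in S -> s \is monic.

Definition same_class p q : bool := `[< kth_power (p%:K / q%:K) >].
(** [choose] depends only on the extension of the predicate once its default satisfies it, so
    equivalent elements of [S] get the same representative. *)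
Definition class_rep p := choose (fun r => (r \in S) && same_class p r) p.
Definition class_reps : {fset {poly F}} := [fset class_rep s | s in S].

Lemma same_class_refl p : p \is monic -> same_class p p.
Proof. by move=> pm; apply/asboolP; rewrite divff ?monic_frac_neq0 //; apply: kth_power1. Qed.

Lemma same_class_trans p q r : q \is monic -> same_class p q -> same_class q r -> same_class p r.
Proof.
move=> qm /asboolP pq /asboolP qr; apply/asboolP.
by have := kth_powerM pq qr; rewrite mulrA divfK ?monic_frac_neq0.
Qed.

Lemma same_class_sym p q : same_class p q -> same_class q p.
Proof. by move=> /asboolP /kth_powerV; rewrite invf_div => ?; apply/asboolP. Qed.

Lemma class_repP s : s \in S -> class_rep s \in S /\ same_class s (class_rep s).
Proof.
move=> sS; apply/andP; rewrite /class_rep.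
by apply: (@chooseP _ (fun r => (r \in S) && same_class s r)); rewrite sS same_class_refl // S_monic.
Qed.

Lemma class_rep_eq s t : s \in S -> t \in S -> same_class s t -> class_rep s = class_rep t.
Proof.
move=> sS tS st; rewrite /class_rep.
have Est : (fun r => (r \in S) && same_class s r) =1 (fun r => (r \in S) && same_class t r).
  move=> r; apply/andP/andP => -[rS h]; split=> //.
    exact: same_class_trans (S_monic sS) (same_class_sym st) h.
  exact: same_class_trans (S_monic tS) st h.
rewrite (eq_choose Est); apply: choose_id; first by rewrite sS same_class_sym.
by rewrite tS same_class_refl ?S_monic.
Qed.

Lemma class_reps_in r : r \in class_reps -> r \in S.
Proof. by move=> /imfsetP [s /= sS ->]; case: (class_repP sS). Qed.

Lemma class_reps_inj r r' : r \in class_reps -> r' \in class_reps -> same_class r r' -> r = r'.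
Proof.
move=> /imfsetP [s /= sS ->] /imfsetP [s' /= sS' ->] rr'.
have [[rS sr] [rS' sr']] := (class_repP sS, class_repP sS').
apply: class_rep_eq => //; apply: same_class_trans sr _; rewrite ?S_monic //.
by apply: same_class_trans rr' (same_class_sym sr'); rewrite S_monic.
Qed.

(* The map [(r, t) |-> r t^k] is injective on representatives times [S]. *)
Lemma card_class_reps : (#|` class_reps| * #|` S| <= #|` powset S k.+1|)%N.
Proof.
pose L := [seq r * t ^+ k | r <- class_reps, t <- S].
have -> : (#|` class_reps| * #|` S|)%N = size L by rewrite size_allpairs.
apply: uniq_leq_size => [|_ /allpairsP [[r t] /= [rT tS ->]]]; last first.
  by apply: mem_mulset; [apply: class_reps_in|apply: mem_powset].
apply: allpairs_uniq; rewrite ?fset_uniq // => x y /allpairsP [[r t] /= [rT tS ->]].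
move=> /allpairsP [[r' t'] /= [rT' tS' ->]] /= E.
have [rS rS'] := (class_reps_in rT, class_reps_in rT').
have rr' : r = r'.
  apply: class_reps_inj => //; apply/asboolP; exists t', t; rewrite !S_monic //; split=> //.
  apply/eqP; rewrite eqr_div ?monic_frac_neq0 ?monic_exp ?S_monic //.
  by rewrite -!rmorphM /= E mulrC.
move: E; rewrite -rr' => /(mulfI (monic_neq0 (S_monic rS))) /monic_exp_inj -> //; exact: S_monic.
Qed.

End Classes.
End KthPowers.

Lemma size_le_fibres (T1 T2 : eqType) (f : T1 -> T2) (s : seq T1) (t : seq T2) m :
    (forall x, x \in s -> f x \in t) ->
    (forall z, (count (fun x => f x == z) s <= m)%N) ->
  (size s <= size t * m)%N.
Proof.
elim: t s => [|z t IH] s st fib; first by case: s st {fib} => // x s /(_ x (mem_head _ _)).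
rewrite -(count_predC (fun x => f x == z) s) /= mulSn leq_add //.
rewrite -size_filter; apply: IH => [x|y].
  by rewrite mem_filter /= => /andP [fx /st]; rewrite inE (negPf fx).
apply: leq_trans (fib y); rewrite count_filter; apply: sub_count => x /=.
by case/andP.
Qed.

(** * Equal sums as nondegenerate solutions in four variables *)

Definition vec4 (T : Type) (a b c d : T) (i : 'I_4) : T := nth a [:: a; b; c; d] i.

Lemma quadruple_nondegenerate (K : fieldType) (a x : 'I_4 -> K) (s1 s2 s3 s4 : K) :
    (forall i, a i * x i = vec4 s1 s2 (- s3) (- s4) i) ->
    s1 + s2 = s3 + s4 ->
    s1 != 0 -> s2 != 0 -> s3 != 0 -> s4 != 0 -> s1 + s2 != 0 -> s3 != s1 -> s3 != s2 ->
  nondegenerate setT a x.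
Proof.
move=> axE E s1_0 s2_0 s3_0 s4_0 s12 s31 s32.
have s4E : s4 = s1 + s2 - s3 by rewrite E addrC addKr.
have sumE (J : {set 'I_4}) : \sum_(i in J) a i * x i =
    (if ord0 \in J then s1 else 0) + ((if lift ord0 ord0 \in J then s2 else 0)
    + ((if lift ord0 (lift ord0 ord0) \in J then - s3 else 0)
    + (if lift ord0 (lift ord0 (lift ord0 ord0)) \in J then - s4 else 0))).
  by rewrite big_mkcond /= !big_ord_recl big_ord0 !axE addr0.
split; first by rewrite sumE !inE s4E; ring.
move=> J J_proper J0; rewrite sumE.
have not_all : ~ forall i, i \in J.
  move=> all_in; move: J_proper; rewrite properEneq => /andP [/eqP []].
  by apply/setP => i; rewrite all_in inE.
have not_none : ~ forall i, i \notin J.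
  by move=> none; case/eqP: J0; apply/setP => i; rewrite (negPf (none i)) inE.
have ord4_ind (P : 'I_4 -> Prop) : P ord0 -> P (lift ord0 ord0) ->
    P (lift ord0 (lift ord0 ord0)) -> P (lift ord0 (lift ord0 (lift ord0 ord0))) -> forall i, P i.
  move=> P0 P1 P2 P3 i; case: (unliftP ord0 i) => [{}i ->|-> //].
  case: (unliftP ord0 i) => [{}i ->|-> //]; case: (unliftP ord0 i) => [{}i ->|-> //].
  by rewrite (ord1 i).
have s13 : s1 - s3 != 0 by rewrite subr_eq0 eq_sym.
have s23 : s2 - s3 != 0 by rewrite subr_eq0 eq_sym.
(* With [s4] eliminated, each proper nonempty subsum is, up to sign, some [s_i], [s1 + s2],
   [s1 - s3] or [s2 - s3]. *)
rewrite s4E in s4_0 *.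
have N0 (u v : K) : u != 0 -> v = - u -> v != 0 by move=> u0 ->; rewrite oppr_eq0.
have E0 (u v : K) : u != 0 -> v = u -> v != 0 by move=> u0 ->.
case: ifP => b0; case: ifP => b1; case: ifP => b2; case: ifP => b3.
- by case: not_all; apply: ord4_ind; rewrite ?b0 ?b1 ?b2 ?b3.
- by apply: (E0 _ _ s4_0); ring.
- by apply: (E0 _ _ s3_0); ring.
- by apply: (E0 _ _ s12); ring.
- by apply: (N0 _ _ s2_0); ring.
- by apply: (E0 _ _ s13); ring.
- by apply: (N0 _ _ s23); ring.
- by apply: (E0 _ _ s1_0); ring.
- by apply: (N0 _ _ s1_0); ring.
- by apply: (E0 _ _ s23); ring.
- by apply: (N0 _ _ s13); ring.
- by apply: (E0 _ _ s2_0); ring.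
- by apply: (N0 _ _ s12); ring.
- by apply: (N0 _ _ s3_0); ring.
- by apply: (N0 _ _ s4_0); ring.
- by case: not_none; apply: ord4_ind; rewrite ?b0 ?b1 ?b2 ?b3.
Qed.

(** The signs go into the coefficients, so that the coordinates [s_i / r_i] can be k-th powers. *)
Lemma quotients_nondegenerate (K : fieldType) (r1 r2 r3 r4 s1 s2 s3 s4 : K) :
    r1 != 0 -> r2 != 0 -> r3 != 0 -> r4 != 0 ->
    s1 + s2 = s3 + s4 ->
    s1 != 0 -> s2 != 0 -> s3 != 0 -> s4 != 0 -> s1 + s2 != 0 -> s3 != s1 -> s3 != s2 ->
  nondegenerate setT (vec4 r1 r2 (- r3) (- r4))
    [ffun i => vec4 (s1 / r1) (s2 / r2) (s3 / r3) (s4 / r4) i].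
Proof.
move=> r1_0 r2_0 r3_0 r4_0; apply: quadruple_nondegenerate.
by case=> [[|[|[|[|]]]]] // ?; rewrite ffunE /vec4 /= ?mulNr mulrC divfK.
Qed.

(** Given the classes and the direction, [s1] determines [s2]: the unknown scalar [c] cancels. *)
Lemma second_from_first (K : fieldType) (r1 r2 s1 s2 y1 y2 c : K) :
    r1 != 0 -> r2 != 0 -> s1 != 0 -> s1 / r1 = c * y1 -> s2 / r2 = c * y2 ->
  s2 = r2 * (y2 / y1) * (s1 / r1).
Proof.
move=> r1_0 r2_0 s1_0 E1 E2.
have : c * y1 != 0 by rewrite -E1 mulf_neq0 ?invr_eq0.
rewrite mulf_eq0 negb_or => /andP [_ y1_0].
have -> : r2 * (y2 / y1) * (s1 / r1) = c * y2 * r2 by rewrite E1; field.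
by rewrite -E2 divfK.
Qed.

Lemma monicD_neq0 (F : numDomainType) (p q : {poly F}) : p \is monic -> q \is monic -> p + q != 0.
Proof.
move=> /monicP pm /monicP qm; apply/eqP => /eqP; rewrite addr_eq0 => /eqP pq.
move: pm; rewrite pq lead_coefN qm => /eqP; rewrite eq_sym -subr_eq0 opprK.
by rewrite -(natrD _ 1 1) pnatr_eq0.
Qed.

(** * Counting sums with a second representation *)

Section Counting.
Variables (F : numClosedFieldType) (N k : nat).
Hypothesis N_ge : (24 <= N)%N.
Hypothesis N_lt_k : (N * N < k)%N.
Local Notation K := {fraction {poly F}}.
Local Notation "p %:K" := (FracField.tofrac p) (at level 2, format "p %:K").

(* [s + t] has a representation other than [s + t] and [t + s]. *)
Definition coincides (S : {fset {poly F}}) (st : {poly F} * {poly F}) : bool :=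
  `[< exists s3 s4, [/\ s3 \in S, s4 \in S, st.1 + st.2 = s3 + s4, s3 != st.1 & s3 != st.2] >].

Definition pairs (S : {fset {poly F}}) := [seq (s, t) | s <- S, t <- S].

Lemma uniq_pairs S : uniq (pairs S).
Proof. by apply: allpairs_uniq; rewrite ?fset_uniq // => -[? ?] [? ?] _ _ [-> ->]. Qed.

Lemma mem_pairs (S : {fset {poly F}}) s t : ((s, t) \in pairs S) = (s \in S) && (t \in S).
Proof.
apply/allpairsP/andP => [[[s' t'] /= [sS tS [-> ->]]] //|[sS tS]].
by exists (s, t).
Qed.

(** A coinciding pair is recovered from the four representatives, [s1], and the index of a
    direction. *)
Lemma few_coincidences : exists B, forall S : {fset {poly F}},
  (forall s, s \in S -> s \is monic) ->
  (count (coincides S) (pairs S) <= (#|` class_reps k S| ^ 4) * (#|` S| * B))%N.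
Proof.
have N_gt1 : (1 < N)%N by apply: leq_trans N_ge.
have [B dirs] := directions F N_gt1 N_lt_k N_ge.
exists B => S S_monic.
have [Y YP] := choice dirs.
pose T := class_reps k S; pose rep := class_rep k S.
pose col (r : ({poly F} * {poly F}) * ({poly F} * {poly F})) :=
  vec4 r.1.1%:K r.1.2%:K (- r.2.1%:K) (- r.2.2%:K).
(* The lists have at most [B] entries while [m] runs over all indices below [B]; the default fills
   the gap. *)
pose direction r m : {ffun 'I_4 -> K} := nth [ffun=> 0] (Y (col r)) m.
pose o0 : 'I_4 := ord0; pose o1 : 'I_4 := lift ord0 ord0.
pose pair_of r (sm : {poly F} * nat) : K * K :=
  (sm.1%:K, r.1.2%:K * (direction r sm.2 o1 / direction r sm.2 o0) * (sm.1%:K / r.1.1%:K)).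
pose Q := [seq (r, r') | r <- T, r' <- T].
pose L := [seq pair_of r sm | r <- [seq (q, q') | q <- Q, q' <- Q],
                              sm <- [seq (s, m) | s <- S, m <- iota 0 B]].
have size_L : size L = (#|` T| ^ 4 * (#|` S| * B))%N.
  by rewrite !size_allpairs size_iota !expnS expn0 muln1 !mulnA.
pose emb (st : {poly F} * {poly F}) : K * K := (st.1%:K, st.2%:K).
have emb_inj : injective emb.
  move=> [s t] [s' t'] [] /eqP + /eqP; rewrite !tofrac_eq => /eqP -> /eqP -> //.
rewrite -/T -size_L -size_filter -(size_map emb); apply: uniq_leq_size.
  by rewrite (map_inj_uniq emb_inj) filter_uniq // uniq_pairs.
move=> _ /mapP [[s1 s2] + ->]; rewrite mem_filter mem_pairs => /andP [].
move=> /asboolP [s3 [s4 /= [s3S s4S E s31 s32]]] /andP [s1S s2S].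
have neq0 s : s \in S -> s%:K != 0 by move=> /S_monic /monic_frac_neq0.
have repP s : s \in S -> [/\ rep s \in T, (rep s)%:K != 0 & kth_power k (s%:K / (rep s)%:K)].
  move=> sS; have [rS /asboolP sr] := class_repP k S_monic sS.
  by split=> //; [apply: in_imfset|apply: neq0].
pose r := ((rep s1, rep s2), (rep s3, rep s4)).
pose x : {ffun 'I_4 -> K} := [ffun i => vec4 (s1%:K / (rep s1)%:K) (s2%:K / (rep s2)%:K)
                                             (s3%:K / (rep s3)%:K) (s4%:K / (rep s4)%:K) i].
have [[r1T r1_0 x1] [r2T r2_0 x2]] := (repP _ s1S, repP _ s2S).
have [[r3T r3_0 x3] [r4T r4_0 x4]] := (repP _ s3S, repP _ s4S).
have xG i : kth_power k (x i) by rewrite ffunE; case: i => [[|[|[|[|]]]]].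
have [Y_le HY] := YP (col r).
have E' : s1%:K + s2%:K = s3%:K + s4%:K by rewrite -!tofracD E.
have s12 : s1%:K + s2%:K != 0 by rewrite -tofracD tofrac_eq0 monicD_neq0 ?S_monic.
have s31' : s3%:K != s1%:K by rewrite tofrac_eq.
have s32' : s3%:K != s2%:K by rewrite tofrac_eq.
have [y yY [c xE]] := HY x xG (quotients_nondegenerate r1_0 r2_0 r3_0 r4_0 E'
  (neq0 _ s1S) (neq0 _ s2S) (neq0 _ s3S) (neq0 _ s4S) s12 s31' s32').
have y_lt : (index y (Y (col r)) < B)%N by apply: leq_trans Y_le; rewrite index_mem.
apply/allpairsP; exists (r, (s1, index y (Y (col r)))); split=> /=.
- by apply/allpairsP; exists ((rep s1, rep s2), (rep s3, rep s4)); split=> //;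
    apply/allpairsP; [exists (rep s1, rep s2)|exists (rep s3, rep s4)].
- by apply/allpairsP; exists (s1, index y (Y (col r))); rewrite mem_iota.
have dirE : direction r (index y (Y (col r))) = y by apply: nth_index.
have x0E : s1%:K / (rep s1)%:K = c * y o0 by rewrite -xE ffunE.
have x1E : s2%:K / (rep s2)%:K = c * y o1 by rewrite -xE ffunE.
rewrite /emb /pair_of dirE; congr (_, _).
exact: second_from_first r1_0 r2_0 (neq0 _ s1S) x0E x1E.
Qed.

(** Among the pairs that do not coincide with others, a fibre of addition contains at most [(s, t)]
    and [(t, s)]. *)
Lemma many_sums (S : {fset {poly F}}) :
  (#|` S| ^ 2 <= count (coincides S) (pairs S) + 2 * #|` sumset S|)%N.
Proof.
have size_P : size (pairs S) = (#|` S| ^ 2)%N by rewrite size_allpairs mulnn.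
rewrite -size_P -(count_predC (coincides S)) leq_add2l mulnC -size_filter.
apply: (@size_le_fibres _ _ (fun st => st.1 + st.2)).
  move=> [s t]; rewrite mem_filter mem_pairs => /andP [_ /andP [sS tS]].
  by apply/imfset2P; exists s => //; exists t.
move=> z; set f := fun _ => _ == z; set good := filter _ _.
rewrite -size_filter; case fibE: (filter f good) => [//|[s t] l]; rewrite -fibE.
have in_fib x : x \in filter f good -> [/\ x.1 \in S, x.2 \in S, x.1 + x.2 = z & ~~ coincides S x].
  case: x => s' t'; rewrite !mem_filter mem_pairs => /andP [/eqP <-].
  by move=> /andP [? /andP [? ?]]; split.
have [|sS tS st /asboolP nost] := in_fib (s, t); first by rewrite fibE mem_head.
apply: (@uniq_leq_size _ _ [:: (s, t); (t, s)]).
  by rewrite !filter_uniq // uniq_pairs.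
move=> [s' t'] /in_fib /= [s'S t'S s't' _]; rewrite !inE.
have E : s' + t' = s + t by rewrite s't'.
have [s's|s's] := eqVneq s' s.
  by move: E; rewrite s's => /addrI ->; rewrite eqxx.
have [s'_t|s'_t] := eqVneq s' t.
  by move: E; rewrite s'_t addrC => /addIr ->; rewrite eqxx orbT.
by case: nost; exists s', t'; split.
Qed.

Theorem monic_sumset : exists B, forall S : {fset {poly F}},
    (forall s, s \in S -> s \is monic) -> (4 * B ^ 2 < #|` S|)%N ->
    (#|` prodset S| ^ (8 * k.+1) < #|` S| ^ (8 * k.+1).+1)%N ->
  (#|` S| ^ 2 <= 4 * #|` sumset S|)%N.
Proof.
have [B few] := few_coincidences; exists B => S S_monic B_lt SS_lt.
have n_gt0 : (0 < #|` S|)%N by apply: leq_ltn_trans B_lt.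
have S0 : 0 \notin S by apply/negP => /S_monic/monic_neq0; rewrite eqxx.
have N_gt1 : (1 < N)%N by apply: leq_trans N_ge.
have T_le : (#|` class_reps k S| * #|` S| ^ k.+1 <= #|` prodset S| ^ k.+1)%N.
  have := plunnecke k.+1 S0; rewrite -cardfs_gt0 => /(_ n_gt0) power_le.
  have T_le := card_class_reps N_gt1 N_lt_k S_monic.
  rewrite -(leq_pmul2r n_gt0) mulnAC; apply: leq_trans power_le.
  by rewrite leq_mul2r T_le orbT.
(* The eighth power of [T_le] against [SS_lt]: the common factor [n ^ (8 * k.+1)] cancels. *)
have T8 : (#|` class_reps k S| ^ 8 < #|` S|)%N.
  rewrite -(ltn_pmul2r (_ : 0 < #|` S| ^ (8 * k.+1))%N) ?expn_gt0 ?n_gt0 // -expnS.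
  apply: leq_ltn_trans SS_lt; rewrite ![(8 * _)%N]mulnC !expnM -expnMn.
  by rewrite leq_exp2r.
have bad_le := few S S_monic; have sums := many_sums S.
move: bad_le sums T8 B_lt n_gt0; move: (count _ _) (#|` class_reps k S|) (#|` S|) (#|` sumset S|).
clear => bad T n sums bad_le sums_ge T8 B_lt n_gt0.
(* Squaring [2 * bad <= 2 * T ^ 4 * n * B] produces [T ^ 8] and [4 * B ^ 2], both below [n]; hence
   the exponent 8 and the threshold on the size of [S]. *)
suff : (2 * bad <= n ^ 2)%N by lia.
rewrite -(leq_exp2r _ _ (_ : 0 < 2)%N) //.
apply: leq_trans (_ : (2 * (T ^ 4 * (n * B))) ^ 2 <= _)%N; first by rewrite leq_exp2r // leq_mul2l.
have -> : ((2 * (T ^ 4 * (n * B))) ^ 2 = T ^ 8 * (4 * B ^ 2) * n ^ 2)%N.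
  by ring.
have -> : ((n ^ 2) ^ 2 = n * n * n ^ 2)%N by ring.
by rewrite leq_mul // leq_mul // ltnW.
Qed.

End Counting.

Local Open Scope complex_scope.

Theorem theorem1 (R : realType) :
  exists c C : R, exists n0 : nat,
    [/\ 0 < c, 0 < C &
      forall n : nat, (n0 <= n)%N ->
      forall S : {fset {poly R[i]}},
        #|` S| = n ->
        (forall p : {poly R[i]}, p \in S -> p \is monic) ->
        (#|` prodset S|)%:R < n%:R `^ (1 + c) :> R ->
        C * n%:R ^+ 2 <= (#|` sumset S|)%:R :> R].
Proof.
have [k k_gt] : exists k, (24 * 24 < k)%N by exists (24 * 24).+1.
have [B HB] := monic_sumset R[i] (leqnn 24) k_gt.
pose m := (8 * k.+1)%N.
have m_gt0 : 0 < m%:R :> R by rewrite ltr0n.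
(* The exponent is [c = 1 / m], so that the [m]-th power of the hypothesis is the integer bound
   [n ^ m.+1] of [monic_sumset]. *)
exists m%:R^-1, 4^-1, (4 * B ^ 2).+1; split; rewrite ?invr_gt0 // => n n_ge S Sn S_monic SS_lt.
have : (#|` S| ^ 2 <= 4 * #|` sumset S|)%N.
  apply: HB => //; rewrite Sn //.
  have n_gt0 : 0 < n%:R :> R by rewrite ltr0n; apply: leq_trans n_ge.
  rewrite -(ltr_nat R) !natrX -powR_mulrn ?ler0n // -[ltRHS]powR_mulrn ?ler0n //.
  have -> : (8 * k.+1).+1%:R = (1 + m%:R^-1) * m%:R :> R.
    by rewrite mulrDl mul1r mulVf ?gt_eqF // -natr1.
  rewrite powRrM; apply: gt0_ltr_powR => //; rewrite nnegrE ?ler0n ?powR_ge0 //.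
by rewrite Sn mulrC ler_pdivrMr // -natrX mulrC -natrM ler_nat.
Qed.
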